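(* Let $\theta\in\mathbf{R}$, let $n\ge 3$ be an integer, and let $p(z)=z^n+e^{i\theta}z$. Then $|p|_0=d(p)$ and $p$ is inextensible with respect to its zero $0$.
   Context: $S_n$ is the set of monic complex polynomials of degree $n\ge 2$ having all their zeros in the closed unit disk $\bar D$. $Z(f)$ denotes the zero set of $f$. For $\alpha\in\mathbf{C}$ put $|p|_\alpha=\min_{w\in Z(p')}|\alpha-w|$, and put $d(p)=\max_{z\in Z(p)}\min_{w\in Z(p')}|z-w|$. Extensibility: let $p\in S_n$ be such that $p$ and $p'$ have only simple zeros, and let $a$ be a zero of $p$ with $|p|_a=d(p)$. Write $p(z)=\prod_{i=1}^n(z-z_i)$ with $z_1=a$, and $p'(z)=n\prod_{j=1}^{n-1}(z-w_j)$, the $w_j$ being labeled so that $|w_j-a|=|p|_a$ for $1\le j\le r$ and $|w_j-a|>|p|_a$ for $j\ge r+1$. For $1\le j\le r$ set $$a_1(w_j)=-\frac{1}{w_j-a}\left[1+\frac{p(w_j)}{(w_j-a)^2p''(w_j)}\right],\qquad a_i(w_j)=-\frac{p(w_j)}{(w_j-a)(w_j-z_i)^2p''(w_j)}\quad(2\le i\le n),$$ and $b_i(w_j)=-z_i^2a_i(w_j)$ for $1\le i\le n$. Let $\mathbf{B}(p)=(\beta_{ij})$ be the $r\times n$ matrix with $\beta_{ij}=a_j(w_i)+\overline{b_j(w_i)}$, $1\le i\le r$, $1\le j\le n$. The polynomial $p$ is called extensible with respect to its zero $a$ if there exists $\vec h\in\mathbf{C}^n$ such that every component of $\Re(\mathbf{B}(p)\vec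 h)$ is strictly positive; otherwise $p$ is called inextensible with respect to $a$. *)

(* Defs.v *)
From HB Require Import structures.
From mathcomp Require Import all_boot all_order all_algebra.
From mathcomp Require Import complex polydiv.
From mathcomp Require Import reals trigo.

Set Implicit Arguments.
Unset Strict Implicit.
Unset Printing Implicit Defensive.

Import Order.TTheory GRing.Theory Num.Theory.
Local Open Scope ring_scope.

Section Definitions.
Variable R : realType.
Local Notation C := R[i].

(* The modulus as an element of the ordered field R, so that minima and maxima
   are taken in R rather than in the partially ordered R[i]. *)
Definition cabs (z : C) : R := Normc.normc z.

(* e^{i theta} *)
Definition expi (theta : R) : C := Complex (cos theta) (sin theta).

(* The zeros of f, repeated according to multiplicity. *)
Definition zeros (f : {poly C}) : seq C := sval (closed_field_poly_normal f).

Lemma zerosE f : f = lead_coef f *: \prod_(c <- zeros f) ('X - c%:P).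
Proof. exact: svalP (closed_field_poly_normal f). Qed.

Lemma mem_zeros f c : f != 0 -> (c \in zeros f) = root f c.
Proof.
move=> f0; rewrite [in RHS](zerosE f) rootZ ?lead_coef_eq0 //.
by rewrite root_prod_XsubC.
Qed.

Definition simple_zeros (f : {poly C}) : Prop :=
  forall c, root f c -> mup c f = 1%N.

Definition monic_in_disk (n : nat) (p : {poly C}) : Prop :=
  [/\ (2 <= n)%N, p \is monic, size p = n.+1 &
      forall c, root p c -> cabs c <= 1].

(* |p|_alpha. The first critical point only serves as the initial value of the
   minimum; it is one of the points over which the minimum is taken. *)
Definition crit_dist (p : {poly C}) (alpha : C) : R :=
  let ws := zeros p^`() in
  \big[Num.min/cabs (alpha - ws`_0)]_(w <- ws) cabs (alpha - w).

(* d(p). The values crit_dist p z are nonnegative, so 0 is neutral here. *)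
Definition max_crit_dist (p : {poly C}) : R :=
  \big[Num.max/0]_(z <- zeros p) crit_dist p z.

(* The indices of z and w start at 0: z`_0 = a is the distinguished zero, and
   w`_0, ..., w`_(r-1) are the critical points nearest to a. *)
Definition labelling (n : nat) (p : {poly C}) (a : C)
    (z : n.-tuple C) (w : n.-1.-tuple C) (r : nat) : Prop :=
  [/\ p = \prod_(c <- z) ('X - c%:P) /\ z`_0 = a,
      p^`() = n%:R *: \prod_(c <- w) ('X - c%:P),
      (r <= n.-1)%N,
      forall j, (j < r)%N -> cabs (w`_j - a) = crit_dist p a &
      forall j, (r <= j < n.-1)%N -> crit_dist p a < cabs (w`_j - a)].

Definition acoef (p : {poly C}) (z : seq C) (j : nat) (w : C) : C :=
  let a := z`_0 in
  if j == 0%N then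
    - (w - a)^-1 * (1 + p.[w] / ((w - a) ^+ 2 * p^`(2).[w]))
  else
    - (p.[w] / ((w - a) * (w - z`_j) ^+ 2 * p^`(2).[w])).

Definition bcoef (p : {poly C}) (z : seq C) (j : nat) (w : C) : C :=
  - z`_j ^+ 2 * acoef p z j w.

Definition Bmatrix (n : nat) (p : {poly C}) (z : n.-tuple C)
    (w : n.-1.-tuple C) (r : nat) : 'M[C]_(r, n) :=
  \matrix_(i < r, j < n)
    (acoef p z j w`_i + Num.conj (bcoef p z j w`_i)).

(* The standing hypotheses under which (in)extensibility is defined. *)
Definition admissible (n : nat) (p : {poly C}) (a : C) : Prop :=
  [/\ monic_in_disk n p, simple_zeros p, simple_zeros p^`(), root p a &
      crit_dist p a = max_crit_dist p].

(* The notion does not depend on the labelling: another one permutes the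
   rows and columns of the matrix. One exists by labelling_exists below. *)
Definition extensible (n : nat) (p : {poly C}) (a : C) : Prop :=
  admissible n p a /\
  exists (z : n.-tuple C) (w : n.-1.-tuple C) (r : nat),
    labelling p a z w r /\
    exists h : 'cV[C]_n,
      forall i : 'I_r, 0 < complex.Re ((Bmatrix p z w r *m h) i 0).

Definition inextensible (n : nat) (p : {poly C}) (a : C) : Prop :=
  admissible n p a /\ ~ extensible n p a.

Lemma cabsN c : cabs (- c) = cabs c.
Proof. by rewrite /cabs; case: c => x y /=; rewrite !sqrrN. Qed.

Lemma labelling_exists n p a : monic_in_disk n p -> root p a ->
  exists (z : n.-tuple C) (w : n.-1.-tuple C) (r : nat), labelling p a z w r.
Proof.
move=> [n2 pm sp _] pa; have p0 : p != 0 by rewrite -size_poly_eq0 sp.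
have n0 : (n%:R : C) != 0 by rewrite pnatr_eq0 -lt0n (leq_trans _ n2).
have cp' : p^`()`_n.-1 = n%:R.
  rewrite coef_deriv prednK ?(leq_trans _ n2) //.
  by move/monicP: pm; rewrite lead_coefE sp /= => ->.
have sp' : size p^`() = n.
  apply/eqP; rewrite eqn_leq -ltnS -sp lt_size_deriv //= -(ltn_predK n2).
  by rewrite ltnNge; apply: contraNN n0 => /(nth_default 0); rewrite cp' => ->.
have lp' : lead_coef p^`() = n%:R by rewrite lead_coefE sp'.
have Ep := zerosE p; rewrite (monicP pm) scale1r in Ep.
have az : a \in zeros p by rewrite mem_zeros.
have pz := perm_to_rem az.
have sz : size (a :: rem a (zeros p)) == n.
  rewrite -(perm_size pz); have := sp; rewrite {1}Ep size_prod_XsubC.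
  by case=> ->.
have Ep' := zerosE p^`(); rewrite lp' in Ep'.
pose near := [pred c | cabs (c - a) == crit_dist p a].
pose u := [seq c <- zeros p^`() | near c].
pose v := [seq c <- zeros p^`() | predC near c].
have pw : perm_eq (u ++ v) (zeros p^`()) by rewrite perm_filterC.
have sw : size (u ++ v) == n.-1.
  rewrite (perm_size pw); have := sp'; rewrite {1}Ep' size_scale //.
  by rewrite size_prod_XsubC => <-.
exists (Tuple sz), (Tuple sw), (size u); split => /=.
- by split=> //; rewrite [LHS]Ep; apply: perm_big.
- by rewrite [LHS]Ep' (perm_big _ pw).
- by rewrite -(eqP sw) size_cat leq_addr.
- move=> j ju; rewrite nth_cat ju.
  by have := mem_nth 0 ju; rewrite mem_filter => /andP[/eqP].
- move=> j /andP[uj jn]; rewrite nth_cat ltnNge uj /=.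
  have jv : (j - size u < size v)%N.
    by rewrite ltn_subLR // -size_cat (eqP sw).
  have := mem_nth 0 jv; rewrite mem_filter => /andP[/= nc cz].
  rewrite lt_neqAle eq_sym nc /= -cabsN opprB /crit_dist.
  exact: ge_bigmin_seq.
Qed.

End Definitions.

(* Main.v *)
(* Write n = m + 1 and c = e^{i theta}. Every critical point satisfies
   w^m = - c / n, so all of them have the same modulus rho with rho^m = 1 / n;
   a nonzero zero z has modulus 1 and rho z is critical, so it lies within
   1 - rho of a critical point, and 1 - rho <= rho because n <= 2^m.
   For inextensibility, r = m and the rows of B(p) add up to 0, so the
   components of Re(B h) cannot all be positive. Indeed p(w)/p''(w) = - w^2 / n
   reduces the column sums of (a_j(w_i)) to sums of (z - w)^-1 and (z - w)^-2
   over the roots w of q = X^m + c / n, that is, to the logarithmic derivatives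
   of q: they are 0 for z = 0 and 1 / z for |z| = 1, and then
   1 / z + conj(- z^2 / z) = 0. *)

Require Import Defs.
From mathcomp Require Import all_boot all_order all_algebra.
From mathcomp Require Import complex reals trigo.
From mathcomp Require Import ring lra.

Set Implicit Arguments.
Unset Strict Implicit.
Unset Printing Implicit Defensive.

Import Order.TTheory GRing.Theory Num.Theory.
Local Open Scope ring_scope.

(** * Derivatives of split polynomials and simplicity of zeros *)

Lemma horner_deriv_prod_XsubC (F : fieldType) (s : seq F) (x : F) :
  x \notin s ->
  (\prod_(c <- s) ('X - c%:P))^`().[x] =
  (\prod_(c <- s) ('X - c%:P)).[x] * \sum_(c <- s) (x - c)^-1.
Proof.
elim: s => [|c s IH]; first by rewrite !big_nil derivC horner0 mulr0.
rewrite inE negb_or -subr_eq0 => /andP[xc /IH {}IH].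
rewrite !big_cons derivM derivXsubC mul1r hornerD !hornerM hornerXsubC IH.
by field.
Qed.

(** With [S] the sum of the [(x - c)^-1], [P' = P S] gives [P'' = P (S^2 + S')], and [S'] is minus
    the sum of the [(x - c)^-2]. *)
Lemma horner_deriv2_prod_XsubC (F : fieldType) (s : seq F) (x : F) :
  x \notin s ->
  (\prod_(c <- s) ('X - c%:P))^`(2).[x] =
  (\prod_(c <- s) ('X - c%:P)).[x] *
    ((\sum_(c <- s) (x - c)^-1) ^+ 2 - \sum_(c <- s) (x - c) ^- 2).
Proof.
elim: s => [|c s IH].
  by rewrite !big_nil derivnC horner0 expr0n subr0 mulr0.
rewrite inE negb_or -subr_eq0 => /andP[xc xs].
have D1 := horner_deriv_prod_XsubC xs.
have D2 := IH xs; rewrite derivnS derivn1 in D2.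
rewrite !big_cons derivnS derivn1 derivM derivXsubC mul1r derivD derivM.
rewrite derivXsubC mul1r !hornerD !hornerM hornerXsubC D2 D1.
by field.
Qed.

(** A factor [('X - c%:P)^2] would leave one factor ['X - c%:P] in the derivative. *)
Lemma simple_zeros_deriv (R : realType) (f : {poly R[i]}) : f != 0 ->
  (forall c, root f c -> f^`().[c] != 0) -> simple_zeros f.
Proof.
move=> f0 H c fc; have := H c fc; apply: contraNeq => m1.
have m2 : (2 <= mup c f)%N.
  by rewrite ltn_neqAle eq_sym m1 mup_geq // expr1 dvdp_XsubCl.
move: m2; rewrite mup_geq // => /dvdpP[g ->].
rewrite derivM expr2 derivM derivXsubC !(hornerXsubC, hornerD, hornerM) subrr.
by rewrite !(mulr0, mul0r, addr0).
Qed.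

(** * The modulus on [R[i]], and a positivity obstruction *)

Lemma cabs_ge0 (R : realType) (z : R[i]) : 0 <= cabs z.
Proof. by case: z => x y; exact: sqrtr_ge0. Qed.

Lemma cabsM (R : realType) (x y : R[i]) : cabs (x * y) = cabs x * cabs y.
Proof. exact: Normc.normcM. Qed.

Lemma cabsX (R : realType) (x : R[i]) k : cabs (x ^+ k) = cabs x ^+ k.
Proof.
by elim: k => [|k IH]; rewrite ?exprS ?cabsM ?IH // !expr0 /cabs Normc.normc1.
Qed.

Lemma normcabs (R : realType) (x : R[i]) : `|x| = (cabs x)%:C%C.
Proof. by []. Qed.

Lemma cabs1_neq0 (R : realType) (z : R[i]) : cabs z = 1 -> z != 0.
Proof.
apply: contra_eq_neq => ->.
by rewrite /cabs Normc.normc0 eq_sym oner_eq0.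
Qed.

Lemma conjC_cabs1 (R : realType) (z : R[i]) : cabs z = 1 -> Num.conj z = z^-1.
Proof.
move=> z1; have nz : `|z| = 1 by rewrite normcabs z1.
by apply: (mulfI (cabs1_neq0 z1)); rewrite -normCK nz expr1n divff ?cabs1_neq0.
Qed.

Lemma cabs_nat (R : realType) k : cabs (k%:R : R[i]) = k%:R.
Proof.
by apply: (@complexI R); rewrite -normcabs normr_nat rmorph_nat.
Qed.

(** The components of [M h] add up to 0, whereas a nonempty sum of positive real parts is
    positive. *)
Lemma col_sum0_not_Re_gt0 (R : realType) r n (M : 'M[R[i]]_(r, n)) :
  (0 < r)%N -> (forall j, \sum_i M i j = 0) ->
  ~ exists h : 'cV[R[i]]_n, forall i, 0 < complex.Re ((M *m h) i 0).
Proof.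
case: r M => // r M _ M0 [h hpos].
suff : 0 < \sum_i complex.Re ((M *m h) i 0).
  have ReD : {morph @complex.Re R : x y / x + y} by case=> ? ? [].
  rewrite -(big_morph _ ReD (erefl : complex.Re 0 = 0)).
  under eq_bigr do rewrite mxE.
  rewrite exchange_big big1 /= ?ltxx // => j _.
  by rewrite -mulr_suml M0 mul0r.
by rewrite big_ord_recl ltr_pwDl // sumr_ge0 // => i _; apply/ltW.
Qed.

(** * The binomial and its critical points *)

Section Binomial.
Variables (R : realType) (c : R[i]) (m : nat).
Hypotheses (c1 : cabs c = 1) (m2 : (2 <= m)%N).

Local Lemma m_gt0 : (0 < m)%N. Proof. exact: ltnW. Qed.
Local Lemma c0 : c != 0. Proof. exact: cabs1_neq0. Qed.
Local Lemma nat_neq0 k : (k.+1%:R : R[i]) != 0. Proof. by rewrite pnatr_eq0. Qed.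
Local Lemma mE : m.-1.+1 = m. Proof. exact: prednK m_gt0. Qed.

#[local] Hint Resolve m_gt0 c0 nat_neq0 : core.

Local Notation p := ('X^(m.+1) + c *: 'X : {poly R[i]}).
Local Notation q := ('X^m + (c / m.+1%:R)%:P : {poly R[i]}).

Lemma derivp : p^`() = m.+1%:R *: q.
Proof.
rewrite derivD derivXn derivZ derivX [RHS]scalerDr; congr (_ + _).
  by rewrite scaler_nat.
by rewrite -[RHS]mul_polyC -polyCM mulrC divfK // alg_polyC.
Qed.

Lemma deriv2p : p^`(2) = (m.+1 * m)%:R *: 'X^(m.-1).
Proof.
rewrite derivnS derivn1 derivp derivZ derivD derivC addr0 derivXn.
by rewrite -[_ *+ m]scaler_nat scalerA -natrM.
Qed.

Lemma size_p : size p = m.+2.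
Proof.
rewrite size_polyDl size_polyXn // size_scale // size_polyX.
by rewrite ltnS ltnW.
Qed.

Lemma p_neq0 : p != 0. Proof. by rewrite -size_poly_eq0 size_p. Qed.

Lemma derivp_neq0 : p^`() != 0.
Proof.
by rewrite derivp scaler_eq0 negb_or nat_neq0 -size_poly_eq0 size_XnaddC.
Qed.

Lemma p_factor : p = 'X * ('X^m + c%:P).
Proof. by rewrite mulrDr -exprS -mul_polyC [_ * 'X]mulrC. Qed.

Lemma root_p z : root p z = (z == 0) || (z ^+ m == - c).
Proof. by rewrite p_factor rootM rootX !rootE !hornerE addr_eq0. Qed.

Lemma root_derivp w : root p^`() w = (w ^+ m == - (c / m.+1%:R)).
Proof. by rewrite derivp rootZ // !rootE !hornerE addr_eq0. Qed.

Lemma crit_neq0 w : root p^`() w -> w != 0.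
Proof.
rewrite root_derivp; apply: contraTneq => ->.
by rewrite expr0n gtn_eqF // eq_sym oppr_eq0 mulf_neq0 // invr_eq0.
Qed.

Lemma deriv2_crit w : root p^`() w -> p^`(2).[w] = - (m%:R * c) / w.
Proof.
move=> wr; have w0 := crit_neq0 wr; move: wr; rewrite root_derivp => /eqP wm.
apply: (mulIf w0); rewrite divfK // deriv2p !hornerE -mulrA -exprSr mE wm natrM.
have := nat_neq0 m; move: (m.+1%:R) (m%:R) => x y x0.
by field.
Qed.

Lemma deriv2_crit_neq0 w : root p^`() w -> p^`(2).[w] != 0.
Proof.
move=> wr; have w0 := crit_neq0 wr.
rewrite deriv2_crit // mulf_neq0 ?oppr_eq0 ?invr_eq0 ?w0 //.
by rewrite mulf_neq0 // pnatr_eq0 -lt0n.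
Qed.

(** Since [w^m = - c / (m+1)], [p(w) = w (w^m + c) = m c w / (m+1)], while [p''(w) = - m c / w]. *)
Lemma horner_crit w : root p^`() w ->
  p.[w] = - (w ^+ 2 / m.+1%:R) * p^`(2).[w].
Proof.
move=> wr; have w0 := crit_neq0 wr; rewrite deriv2_crit //.
move: wr; rewrite root_derivp => /eqP wm.
rewrite p_factor hornerM hornerX hornerD hornerXn hornerC wm.
have -> : (m%:R : R[i]) = m.+1%:R - 1 by rewrite -natr1 addrK.
have := nat_neq0 m; move: (m.+1%:R) => x x0.
by field; apply/andP.
Qed.

Lemma cabs_zero z : z ^+ m = - c -> cabs z = 1.
Proof.
move/(congr1 (@cabs R)); rewrite cabsX cabsN c1 => /eqP.
by rewrite pexpr_eq1 ?cabs_ge0 // => /eqP.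
Qed.

Lemma cabs_crit w : root p^`() w -> cabs w ^+ m = m.+1%:R^-1.
Proof.
rewrite root_derivp => /eqP/(congr1 (@cabs R)).
by rewrite cabsX cabsN cabsM c1 mul1r {2}/cabs Normc.normcV -/(cabs _) cabs_nat.
Qed.

Lemma has_crit : exists w, root p^`() w.
Proof.
apply/closed_rootP; rewrite derivp size_scale // size_XnaddC //.
by case: (m) m_gt0.
Qed.

Lemma cabs_crit_eq v w : root p^`() v -> root p^`() w -> cabs v = cabs w.
Proof.
move=> /cabs_crit vm /cabs_crit wm.
by apply: (@pexpIrn _ m); rewrite ?nnegrE ?cabs_ge0 //= vm wm.
Qed.

(** * Distances from zeros to critical points *)

Lemma crit_dist0 w : root p^`() w -> crit_dist p 0 = cabs w.
Proof.
move=> wr; have zr v : v \in zeros p^`() -> cabs (0 - v) = cabs w.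
  by rewrite mem_zeros ?derivp_neq0 // sub0r cabsN => /cabs_crit_eq; apply.
rewrite /crit_dist big_seq; elim/big_ind: _ => [|x y -> ->|v /zr //].
(* The initial value of the minimum is a genuine critical point because the list of critical points
   is nonempty. *)
- apply/zr/mem_nth; rewrite lt0n size_eq0.
  by apply: contraTneq wr => z0; rewrite -mem_zeros ?derivp_neq0 // z0.
- by rewrite minxx.
Qed.

Lemma half_le_cabs_crit w : root p^`() w -> 1 - cabs w <= cabs w.
Proof.
move=> wr; suff : 2^-1 <= cabs w by lra.
rewrite -(@ler_pXn2r _ m) ?nnegrE ?cabs_ge0 ?invr_ge0 // cabs_crit //.
rewrite exprVn lef_pV2 ?posrE ?exprn_gt0 ?ltr0n //.
by rewrite -natrX ler_nat ltn_expl.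
Qed.

Lemma crit_dist_le z : root p z -> crit_dist p z <= crit_dist p 0.
Proof.
rewrite root_p; case: eqP => [-> //|_ /= /eqP zm].
have [w wr] := has_crit; rewrite (crit_dist0 wr).
(* [rho * z] is the critical point on the segment from 0 to [z]: its [m]-th power is
   [- c * rho^m = - c / (m+1)]. *)
pose rho : R[i] := (cabs w)%:C%C.
have vr : root p^`() (rho * z).
  rewrite root_derivp exprMn zm -rmorphXn /= cabs_crit // fmorphV rmorph_nat.
  by rewrite mulrN mulrC.
apply: le_trans (half_le_cabs_crit wr).
apply: (@le_trans _ _ (cabs (z - rho * z))).
  by apply: ge_bigmin_seq => //; rewrite mem_zeros // derivp_neq0.
have -> : z - rho * z = (1 - cabs w)%:C%C * z.
  by rewrite rmorphB /= mulrBl mul1r.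
rewrite cabsM (cabs_zero zm) mulr1 /cabs /= expr0n addr0 sqrtr_sqr ger0_norm //.
rewrite subr_ge0 -(@ler_pXn2r _ m) ?nnegrE ?cabs_ge0 //.
by rewrite cabs_crit // expr1n invf_le1 ?ltr0n // ler1n.
Qed.

Lemma root_p0 : root p 0. Proof. by rewrite root_p eqxx. Qed.

Lemma crit_dist0_max : crit_dist p 0 = max_crit_dist p.
Proof.
have [w wr] := has_crit.
apply/eqP; rewrite eq_le; apply/andP; split.
  by apply: le_bigmax_seq => //; rewrite mem_zeros ?p_neq0 // root_p0.
rewrite /max_crit_dist big_seq; apply: bigmax_le => [|z].
  by rewrite (crit_dist0 wr) cabs_ge0.
by rewrite mem_zeros ?p_neq0 //; apply: crit_dist_le.
Qed.

(** * Admissibility at the zero 0 *)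

Lemma admissible_p0 : admissible m.+1 p 0.
Proof.
split; last exact: crit_dist0_max.
- split; rewrite ?size_p // ?ltnS //.
    by rewrite monicE lead_coefE size_p !coefE eqxx gtn_eqF ?mulr0 ?addr0 ?ltnS.
  move=> z; rewrite root_p => /orP[/eqP-> | /eqP/cabs_zero -> //].
  by rewrite /cabs Normc.normc0.
(* At a common zero of [p] and [p'], [horner_crit] would make [z^2 p''(z)] vanish, but neither
   factor does. *)
- apply: simple_zeros_deriv p_neq0 _ => z pz; apply/negP => dz.
  have /eqP := horner_crit dz; rewrite (rootP pz) eq_sym mulf_eq0.
  rewrite (negPf (deriv2_crit_neq0 dz)) oppr_eq0 mulf_eq0 invr_eq0.
  by rewrite (negPf (nat_neq0 m)) expf_eq0 (negPf (crit_neq0 dz)).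
- apply: simple_zeros_deriv derivp_neq0 _ => w /deriv2_crit_neq0.
  by rewrite derivnS derivn1.
- exact: root_p0.
Qed.

(** * Column sums of the matrix *)

Lemma nonzero_zero (z : seq R[i]) j :
  p = \prod_(x <- z) ('X - x%:P) -> z`_0 = 0 -> (j < size z)%N -> j != 0%N ->
  (z`_j) ^+ m = - c.
Proof.
case: z => [|y z] //= pz y0; case: j => // j; rewrite ltnS => jz _.
(* Cancelling ['X] against the entry of index 0 leaves [X^m + c], whose roots are all the other
   entries. *)
move: pz; rewrite big_cons y0 subr0 p_factor => /(mulfI _) E.
have : root ('X^m + c%:P) z`_j.
  by rewrite E ?polyX_eq0 // root_prod_XsubC mem_nth.
by rewrite rootE !hornerE addr_eq0 => /eqP.
Qed.

Lemma sum_acoef (z w : seq R[i]) j :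
  p = \prod_(x <- z) ('X - x%:P) -> z`_0 = 0 -> (j < size z)%N ->
  q = \prod_(x <- w) ('X - x%:P) ->
  \sum_(x <- w) acoef p z j x = if j == 0%N then 0 else (z`_j)^-1.
Proof.
move=> pz z0 jz qw.
have wr x : x \in w -> root p^`() x.
  by move=> xw; rewrite derivp rootZ // qw root_prod_XsubC.
have q0 : q.[0] = c / m.+1%:R by rewrite !hornerE expr0n gtn_eqF ?add0r.
rewrite /acoef z0; case: eqP => [_ | /eqP j0].
  (* The exponent in [q' = m X^(m-1)] is positive because [m >= 2]. *)
  have D : q^`().[0] = 0.
    rewrite derivD derivC addr0 derivXn hornerMn hornerXn expr0n.
    by rewrite gtn_eqF ?mul0rn // -ltnS mE.
  have w0 : 0 \notin w by apply/negP => /wr/crit_neq0; rewrite eqxx.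
  have := horner_deriv_prod_XsubC w0; rewrite -qw D q0 => /esym/eqP.
  rewrite !mulf_eq0 invr_eq0 (negPf c0) (negPf (nat_neq0 m)) /= => /eqP S.
  (* As [p(x) / (x^2 p''(x)) = - 1 / (m+1)], every term is the same multiple of [(0 - x)^-1]. *)
  transitivity (\sum_(x <- w) (0 - x)^-1 * (1 - m.+1%:R^-1)); last first.
    by rewrite -mulr_suml S mul0r.
  apply: eq_big_seq => x /wr xr; have x0 := crit_neq0 xr.
  rewrite horner_crit // subr0 sub0r invrN; congr (_ * (1 + _)).
  have := deriv2_crit_neq0 xr; have := nat_neq0 m.
  move: (m.+1%:R) (p^`(2).[x]) => a b a0 b0.
  by field; apply/and3P.
have zm := nonzero_zero pz z0 jz j0.
move: (z`_j) zm => {z pz z0 jz j0 j} z zm.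
have z0 : z != 0 := cabs1_neq0 (cabs_zero zm).
have mn : (m%:R : R[i]) = m.+1%:R - 1 by rewrite -natr1 addrK.
have mn0 : (m.+1%:R - 1 : R[i]) != 0 by rewrite -mn pnatr_eq0 -lt0n.
have qz : q.[z] = - c * m%:R / m.+1%:R.
  rewrite !hornerE zm mn; have := nat_neq0 m; move: (m.+1%:R) => a a0.
  by field.
have qz0 : q.[z] != 0.
  by rewrite qz mn mulf_neq0 ?invr_eq0 // mulf_neq0 // oppr_eq0.
have zw : z \notin w by rewrite -root_prod_XsubC -qw rootE.
(* From [z^m = - c]: [q'(z) = - m c / z] and [q''(z) = - m (m-1) c / z^2], each to be divided by
   [q(z) = - m c / (m+1)]; [m - 1] is written [(m+1) - 2]. *)
have D1 : q^`().[z] = q.[z] * (m.+1%:R / z).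
  rewrite derivD derivC addr0 derivXn hornerMn hornerXn.
  apply: (mulIf z0); rewrite -[z ^+ _ *+ m]mulr_natr mulrAC -exprSr mE zm qz.
  have := nat_neq0 m; move: (m.+1%:R) => a a0.
  by field; apply/andP.
have D2 : q^`(2).[z] = q.[z] * (m.+1%:R * (m.+1%:R - 2) / z ^+ 2).
  rewrite derivnS derivn1 derivD derivC addr0 derivXn derivMn derivXn.
  rewrite !hornerMn hornerXn.
  apply: (mulIf (expf_neq0 2 z0)).
  rewrite -[z ^+ _ *+ _]mulr_natr -[_ * _ *+ m]mulr_natr [LHS]mulrC !mulrA.
  have -> : z ^+ 2 * z ^+ m.-2 = - c.
    by rewrite -exprD add2n; case: m m2 zm => [|[|k]].
  rewrite qz.
  have -> : (m.-1%:R : R[i]) = m%:R - 1 by rewrite -{2}mE -natr1 addrK.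
  rewrite mn; have := nat_neq0 m; move: (m.+1%:R) => a a0.
  by field; apply/andP.
have := horner_deriv_prod_XsubC zw; rewrite -qw D1 => /(mulfI qz0) S1.
have := horner_deriv2_prod_XsubC zw; rewrite -qw D2 => /(mulfI qz0).
rewrite -S1 => S2.
(* x / (x - z)^2 = z / (z - x)^2 - 1 / (z - x) *)
transitivity (\sum_(x <- w) (z * (z - x) ^- 2 - (z - x)^-1) / m.+1%:R).
  apply: eq_big_seq => x xw; have xr := wr _ xw; have x0 := crit_neq0 xr.
  have zx : z - x != 0 by rewrite subr_eq0; apply: contraNneq zw => ->.
  have xz : x - z != 0 by rewrite -opprB oppr_eq0.
  rewrite horner_crit // subr0.
  have := deriv2_crit_neq0 xr; have := nat_neq0 m.
  move: (m.+1%:R) (p^`(2).[x]) => a b a0 b0.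
  by field; rewrite ?a0 ?b0 ?x0 ?zx ?xz.
rewrite -mulr_suml big_split /= sumrN -mulr_sumr -S1.
(* This sum equals [2 (m+1) / z^2], so the total is [(2 (m+1) / z - (m+1) / z) / (m+1) = 1 / z]. *)
have -> : \sum_(x <- w) (z - x) ^- 2 =
   (m.+1%:R / z) ^+ 2 - m.+1%:R * (m.+1%:R - 2) / z ^+ 2.
  by rewrite S2 opprB addrC subrK.
have := nat_neq0 m; move: (m.+1%:R) => a a0.
by field; apply/andP.
Qed.

Lemma sum_Bmatrix (z : m.+1.-tuple R[i]) (w : m.-tuple R[i]) (j : 'I_m.+1) :
  p = \prod_(x <- z) ('X - x%:P) -> z`_0 = 0 ->
  q = \prod_(x <- w) ('X - x%:P) ->
  \sum_(i < m) Bmatrix p z (w : m.+1.-1.-tuple R[i]) m i j = 0.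
Proof.
move=> pz z0 qw.
under eq_bigr => i _ do rewrite mxE /bcoef.
have S := @sum_acoef z w j pz z0 _ qw; rewrite size_tuple in S.
have {}S := S (ltn_ord j).
rewrite big_split /= -rmorph_sum -mulr_sumr.
have -> : \sum_(i < m) acoef p z j w`_i = \sum_(x <- w) acoef p z j x.
  by rewrite (big_nth 0) size_tuple big_mkord.
rewrite S; case: eqP => [_ | /eqP j0]; first by rewrite mulr0 rmorph0 addr0.
have jz : (j < size z)%N by rewrite size_tuple.
have /conjC_cabs1 zJ := cabs_zero (nonzero_zero pz z0 jz j0).
have zj0 := cabs1_neq0 (cabs_zero (nonzero_zero pz z0 jz j0)).
by rewrite mulNr expr2 mulfK // rmorphN /= zJ subrr.
Qed.

(** * Inextensibility for every labelling *)

Lemma not_extensible_p0 : ~ extensible m.+1 p 0.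
Proof.
move=> [_ [z [w [r [[[pz z0] dw rm _ far] hB]]]]].
have qw : q = \prod_(x <- w) ('X - x%:P).
  by apply: (scalerI (nat_neq0 m)); rewrite -derivp.
have wr i : (i < m)%N -> root p^`() w`_i.
  move=> im; rewrite derivp rootZ // qw root_prod_XsubC mem_nth //.
  by rewrite size_tuple.
(* The critical points lie on one circle about 0, so none can be strictly farther than the
   nearest. *)
have rE : r = m.
  apply/eqP; rewrite eqn_leq rm leqNgt; apply/negP => rlt.
  have := far r; rewrite leqnn subr0 => /(_ rlt).
  by rewrite (crit_dist0 (wr _ rlt)) ltxx.
subst r; apply: col_sum0_not_Re_gt0 m_gt0 _ hB => j.
exact: sum_Bmatrix.
Qed.

End Binomial.

Theorem theorem1p2 (R : realType) (theta : R) (n : nat) (hn : (3 <= n)%N)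
    (p : {poly R[i]}) (hp : p = 'X^n + expi theta *: 'X) :
  crit_dist p 0 = max_crit_dist p /\ inextensible n p 0.
Proof.
case: n hn hp => // m m2 ->.
have c1 : cabs (expi theta) = 1 by rewrite /cabs /= cos2Dsin2 sqrtr1.
split; first exact: crit_dist0_max.
by split; [exact: admissible_p0 | exact: not_extensible_p0].
Qed.
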